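(* Let $j$ be a positive integer, and define \[ A=\begin{bmatrix}1&1&1&1\\1&1&-1&-1\end{bmatrix},\quad B=\begin{bmatrix}1&1&0&0\\-1&-1&0&0\\0&0&1&1\\0&0&-1&-1\end{bmatrix},\quad D=\begin{bmatrix}-1&1\\1&-1\\-1&-1\\1&1\end{bmatrix}. \] Let $S$ be the $(4j+4)\times(4j+4)$ block matrix with block rows/columns of sizes $2,4,\dots,4,2$ ($j$ blocks of size $4$) in which the $(1,2)$ block is $A$ and the $(2,1)$ block is $-A^T$; the $(k,k+1)$ block is $B$ and the $(k+1,k)$ block is $-B^T$ for $2\le k\le j$; the $(j+1,j+2)$ block is $D$ and the $(j+2,j+1)$ block is $-D^T$; and all other blocks are zero. Then $S$ is the skew-adjacency matrix of an orientation $\mathcal{H}_j^\sigma$ of $\mathcal{H}_j$, with rows/columns ordered $u,v,u_1,u_2,v_1,v_2,u_3,u_4,v_3,v_4,\dots,u_{2j-1},u_{2j},v_{2j-1},v_{2j},u_{2j+1},u_{2j+2}$, and $S^TS=4I$; that is, $\mathcal{H}_j^\sigma$ has optimum skew energy.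
   Context: For a simple graph $G$ on vertices $v_1,\dots,v_n$ with orientation $\sigma$, the skew-adjacency matrix $S(G^\sigma)=[s_{ij}]$ has $s_{ij}=1$, $s_{ji}=-1$ if $\langle v_i,v_j\rangle$ is an arc and $0$ for non-adjacent pairs. Optimum skew energy means the sum of absolute values of the eigenvalues of $S(G^\sigma)$ equals $n\sqrt{\Delta}$ ($\Delta$ the maximum degree), equivalently $S^TS=\Delta I_n$. $\mathcal{H}_j$ is the graph on vertices $u,v,u_1,\dots,u_{2j+2},v_1,\dots,v_{2j}$: $u,v$ each adjacent to $u_1,u_2,v_1,v_2$; for $k=1,\dots,j$, each of $u_{2k-1},u_{2k}$ adjacent to each of $u_{2k+1},u_{2k+2}$; for $k=1,\dots,j-1$, each of $v_{2k-1},v_{2k}$ adjacent to each of $v_{2k+1},v_{2k+2}$; each of $v_{2j-1},v_{2j}$ adjacent to each of $u_{2j+1},u_{2j+2}$. *)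

(* Defs.v *)
From HB Require Import structures.
From mathcomp Require Import all_boot all_order all_algebra all_field.
From mathcomp Require Import zify.

Set Implicit Arguments.
Unset Strict Implicit.
Unset Printing Implicit Defensive.

Import Order.TTheory GRing.Theory Num.Theory.

Local Open Scope ring_scope.

Record sgraph (T : finType) := SGraph {
  adj : rel T;
  adj_sym : symmetric adj;
  adj_irrefl : irreflexive adj
}.

Definition degree (T : finType) (G : sgraph T) (x : T) : nat :=
  #|[set y | adj G x y]|.

Definition max_degree (T : finType) (G : sgraph T) : nat :=
  (\max_(x : T) degree G x)%N.

Record orientation (T : finType) (G : sgraph T) := Orientation {
  arc : rel T;
  arc_adj : forall x y, adj G x y = arc x y || arc y x;
  arc_asym : forall x y, arc x y -> ~~ arc y x
}.

Record vertex_order (n : nat) (T : finType) := VertexOrder {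
  vertex_at :> 'I_n -> T;
  vertex_at_bij : bijective vertex_at
}.

Definition enum_order (T : finType) : vertex_order #|T| T :=
  VertexOrder (@enum_val_bij T).

Definition skew_adj (T : finType) (G : sgraph T) (sigma : orientation G)
    (n : nat) (w : vertex_order n T) : 'M[int]_n :=
  \matrix_(a, b) (if arc sigma (w a) (w b) then 1
                  else if arc sigma (w b) (w a) then -1 else 0).

(** The eigenvalues are listed with algebraic multiplicity. *)
Definition eigenvalues (n : nat) (M : 'M[algC]_n) : seq algC :=
  sval (closed_field_poly_normal (char_poly M)).

(** The spectrum does not depend on the order of the vertices. *)
Definition skew_energy (T : finType) (G : sgraph T) (sigma : orientation G)
    : algC :=
  \sum_(z <- eigenvalues (map_mx intr (skew_adj sigma (enum_order T)))) `|z|.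

Definition optimum_skew_energy (T : finType) (G : sgraph T)
    (sigma : orientation G) : Prop :=
  skew_energy sigma = #|T|%:R * sqrtC (max_degree G)%:R.

(** [Lui k] and [Lvi k] stand for $u_k$ and $v_k$, with k starting at 1. *)
Inductive label := Lu | Lv | Lui of nat | Lvi of nat.

Definition label_code (x : label) : bool + (nat + nat) :=
  match x with
  | Lu => inl true
  | Lv => inl false
  | Lui k => inr (inl k)
  | Lvi k => inr (inr k)
  end.

Definition label_decode (c : bool + (nat + nat)) : label :=
  match c with
  | inl b => if b then Lu else Lv
  | inr (inl k) => Lui k
  | inr (inr k) => Lvi k
  end.

Lemma label_codeK : cancel label_code label_decode.
Proof. by case. Qed.

HB.instance Definition _ := Countable.copy label (can_type label_codeK).

Section HGraph.
Local Open Scope nat_scope.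
Variable j : nat.

Definition H_labels : seq label :=
  [:: Lu; Lv] ++ [seq Lui k | k <- iota 1 (2 * j + 2)]
              ++ [seq Lvi k | k <- iota 1 (2 * j)].

Definition H_vertex : finType := seq_sub H_labels.

(** Each edge is listed in one direction only. *)
Definition H_edges : seq (label * label) :=
  [seq (x, y) | x <- [:: Lu; Lv], y <- [:: Lui 1; Lui 2; Lvi 1; Lvi 2]]
  ++ flatten [seq [seq (x, y) | x <- [:: Lui (2 * k - 1); Lui (2 * k)],
                                y <- [:: Lui (2 * k + 1); Lui (2 * k + 2)]]
             | k <- iota 1 j]
  ++ flatten [seq [seq (x, y) | x <- [:: Lvi (2 * k - 1); Lvi (2 * k)],
                                y <- [:: Lvi (2 * k + 1); Lvi (2 * k + 2)]]
             | k <- iota 1 (j - 1)]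
  ++ [seq (x, y) | x <- [:: Lvi (2 * j - 1); Lvi (2 * j)],
                   y <- [:: Lui (2 * j + 1); Lui (2 * j + 2)]].

Definition H_adj : rel H_vertex :=
  fun x y => ((val x, val y) \in H_edges) || ((val y, val x) \in H_edges).

Lemma H_adj_sym : symmetric H_adj.
Proof. by move=> x y; rewrite /H_adj orbC. Qed.

Lemma H_edges_irrefl x : (x, x) \notin H_edges.
Proof.
have eqU a b : (Lui a == Lui b) = (a == b) by [].
have eqV a b : (Lvi a == Lvi b) = (a == b) by [].
suff /allP H : all (fun e => e.1 != e.2) H_edges.
  by apply/negP => /H; rewrite eqxx.
rewrite /H_edges all_cat; apply/andP; split=> //.
rewrite all_cat; apply/andP; split; last (rewrite all_cat andbC; apply/andP; split=> //).
  apply/allP => e /flattenP[s /mapP[k]]; rewrite mem_iota => /andP[k0 _] ->.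
  by move: e; apply/allP; rewrite /= !eqU; lia.
apply/allP => e /flattenP[s /mapP[k]]; rewrite mem_iota => /andP[k0 _] ->.
by move: e; apply/allP; rewrite /= !eqV; lia.
Qed.

Lemma H_adj_irrefl : irreflexive H_adj.
Proof. by move=> x; rewrite /H_adj orbb (negbTE (H_edges_irrefl _)). Qed.

Definition H_graph : sgraph H_vertex := SGraph H_adj_sym H_adj_irrefl.

Definition H_order_seq : seq label :=
  [:: Lu; Lv]
  ++ flatten [seq [:: Lui (2 * k - 1); Lui (2 * k);
                      Lvi (2 * k - 1); Lvi (2 * k)] | k <- iota 1 j]
  ++ [:: Lui (2 * j + 1); Lui (2 * j + 2)].

Lemma size_H_order_seq : size H_order_seq = 4 * j + 4.
Proof.
rewrite !size_cat size_flatten /shape -map_comp /=.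
rewrite (eq_map (g := fun=> 4)) // sumnE big_map big_const_seq count_predT.
by rewrite size_iota iter_addn; lia.
Qed.

Lemma uniq_H_labels : uniq H_labels.
Proof.
have injU : injective Lui by move=> ? ? [].
have injV : injective Lvi by move=> ? ? [].
rewrite /H_labels cat_uniq cat_uniq !(map_inj_uniq injU) !(map_inj_uniq injV).
rewrite !iota_uniq /= andbT; apply/andP; split.
  by apply/hasPn => x; rewrite mem_cat => /orP[] /mapP[k _ ->].
by apply/hasPn => x /mapP[k _ ->]; apply/mapP => -[].
Qed.

Lemma size_H_labels : size H_labels = 4 * j + 4.
Proof. by rewrite !size_cat !size_map !size_iota /=; lia. Qed.

Lemma sub_H_order_seq : {subset H_labels <= H_order_seq}.
Proof.
have blk k i : 0 < k <= j ->
    i \in [:: Lui (2 * k - 1); Lui (2 * k); Lvi (2 * k - 1); Lvi (2 * k)] ->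
    i \in H_order_seq.
  move=> kj ik; rewrite !mem_cat; apply/or3P/Or32/flattenP.
  by eexists; [apply: (map_f _ (x := k)); rewrite mem_iota; lia | exact: ik].
move=> x; rewrite 2!mem_cat => /or3P[xuv|/mapP[k]|/mapP[k]].
- by rewrite mem_cat xuv.
- rewrite mem_iota => kj ->; have [k2j|k2j] := leqP k (2 * j).
    have [kE|kE] : k = 2 * k.+1./2 - 1 \/ k = 2 * k.+1./2 by lia.
      by apply: (blk k.+1./2); [lia | rewrite -kE !inE eqxx ?orbT].
    by apply: (blk k.+1./2); [lia | rewrite -kE !inE eqxx ?orbT].
  have [->|->] : k = 2 * j + 1 \/ k = 2 * j + 2 by lia.
    by rewrite !mem_cat !inE eqxx ?orbT.
  by rewrite !mem_cat !inE eqxx ?orbT.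
- rewrite mem_iota => kj ->.
  have [kE|kE] : k = 2 * k.+1./2 - 1 \/ k = 2 * k.+1./2 by lia.
    by apply: (blk k.+1./2); [lia | rewrite -kE !inE eqxx ?orbT].
  by apply: (blk k.+1./2); [lia | rewrite -kE !inE eqxx ?orbT].
Qed.

Lemma size_H_order_labels : size H_order_seq <= size H_labels.
Proof. by rewrite size_H_order_seq size_H_labels. Qed.

Lemma mem_H_order_seq : H_labels =i H_order_seq.
Proof.
exact: (uniq_min_size uniq_H_labels sub_H_order_seq size_H_order_labels).2.
Qed.

Lemma uniq_H_order_seq : uniq H_order_seq.
Proof.
exact: leq_size_uniq uniq_H_labels sub_H_order_seq size_H_order_labels.
Qed.

Lemma nth_H_order_seq (i : 'I_(4 * j + 4)) : nth Lu H_order_seq i \in H_labels.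
Proof. by rewrite mem_H_order_seq mem_nth // size_H_order_seq. Qed.

Definition H_vertex_at (i : 'I_(4 * j + 4)) : H_vertex :=
  SeqSub (nth_H_order_seq i).

Lemma H_vertex_at_bij : bijective H_vertex_at.
Proof.
apply: inj_card_bij; last first.
  by rewrite card_seq_sub ?uniq_H_labels // size_H_labels card_ord.
move=> i k /(congr1 val) /= /eqP.
by rewrite nth_uniq ?size_H_order_seq ?uniq_H_order_seq // => /eqP/val_inj.
Qed.

Definition H_order : vertex_order (4 * j + 4) H_vertex :=
  VertexOrder H_vertex_at_bij.

End HGraph.

Definition mx_of_rows (m n : nat) (rows : seq (seq int)) : 'M[int]_(m, n) :=
  \matrix_(a, b) nth 0 (nth [::] rows a) b.

Definition A_mx : 'M[int]_(2, 4) :=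
  mx_of_rows 2 4 [:: [:: 1; 1; 1; 1];
                     [:: 1; 1; -1; -1]].

Definition B_mx : 'M[int]_4 :=
  mx_of_rows 4 4 [:: [:: 1; 1; 0; 0];
                     [:: -1; -1; 0; 0];
                     [:: 0; 0; 1; 1];
                     [:: 0; 0; -1; -1]].

Definition D_mx : 'M[int]_(4, 2) :=
  mx_of_rows 4 2 [:: [:: -1; 1];
                     [:: 1; -1];
                     [:: -1; -1];
                     [:: 1; 1]].

Section SMatrix.
Variable j : nat.

(** Blocks are numbered 0, ..., j+1. *)
Definition block_size (k : 'I_j.+2) : nat :=
  if (k == 0%N :> nat) || (k == j.+1 :> nat) then 2 else 4.

(** The block (k, l) for l = k+1 and 0 < j.  Then [conform_mx 0] always meets
    equal dimensions, and only serves to identify [block_size] with its value. *)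
Definition upper_block (k l : 'I_j.+2) :
    'M[int]_(block_size k, block_size l) :=
  if k == 0%N :> nat then conform_mx 0 A_mx
  else if k == j :> nat then conform_mx 0 D_mx
  else conform_mx 0 B_mx.

Definition S_block (k l : 'I_j.+2) : 'M[int]_(block_size k, block_size l) :=
  if l == k.+1 :> nat then upper_block k l
  else if k == l.+1 :> nat then - (upper_block l k)^T
  else 0.

Lemma sum_block_size : (\sum_(k < j.+2) block_size k)%N = (4 * j + 4)%N.
Proof.
rewrite big_ord_recl big_ord_recr /= /block_size /= eqxx ?orbT.
rewrite (eq_bigr (fun=> 4%N)) => [|k _].
  by rewrite sum_nat_const card_ord; lia.
by rewrite /bump /= add1n eqSS ltn_eqF.
Qed.

Definition S_mx : 'M[int]_(4 * j + 4) :=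
  castmx (sum_block_size, sum_block_size)
    (\mxblock_(k < j.+2, l < j.+2) S_block k l).

End SMatrix.

(* Main.v *)
(** Idea: the columns of [S] are orthogonal block by block.  Each block row of
    [S] has at most two nonzero blocks, and [A B = B B = B D = A D = 0] whenever
    these products occur, so only the diagonal blocks of [S^T S] survive; there
    [A A^T = D^T D = 4 I], and on a middle block the contribution
    [A^T A = B^T B = 2 (J + J)] of the left neighbour and [B B^T = D D^T] of the
    right neighbour (the same with negated off-diagonal entries) add up to [4 I].
    Then [S] being skew-symmetric gives [S^2 = -4 I], so every eigenvalue has
    modulus 2, while the diagonal of [S^T S] shows that the graph is 4-regular. *)

Require Import Defs.
From mathcomp Require Import all_boot all_order all_algebra all_field.
From mathcomp Require Import zify.

Set Implicit Arguments.
Unset Strict Implicit.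
Unset Printing Implicit Defensive.

Import Order.TTheory GRing.Theory Num.Theory.

Local Open Scope ring_scope.

(** * Skew energy from a Gram identity [S^T S = d I] *)

Section SkewSpectrum.
Variables (T : finType) (G : sgraph T) (sigma : orientation G).

Lemma skew_adj_tr n (w : vertex_order n T) :
  (skew_adj sigma w)^T = - skew_adj sigma w.
Proof.
apply/matrixP=> a b; rewrite !mxE; case: ifP => [ab|_].
  by rewrite (negbTE (arc_asym ab)).
by case: ifP; rewrite ?opprK ?oppr0.
Qed.

Lemma skew_adj_sqr_entry n (w : vertex_order n T) a b :
  skew_adj sigma w a b ^+ 2 = (adj G (w a) (w b))%:R.
Proof. by rewrite mxE (arc_adj sigma); do 2 case: ifP => _ //. Qed.

(** Reordering the vertices only permutes the summation index. This carries the identity over to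
    [enum_order], in which [skew_energy] is computed. *)
Lemma skew_adj_gram_order n m (w : vertex_order n T) (w' : vertex_order m T)
    (d : int) :
  (skew_adj sigma w)^T *m skew_adj sigma w = d%:M ->
  (skew_adj sigma w')^T *m skew_adj sigma w' = d%:M.
Proof.
move=> gram; have [g gK Kg] := vertex_at_bij w.
have [g' gK' Kg'] := vertex_at_bij w'.
apply/matrixP=> a b.
have /matrixP/(_ (g (w' a)) (g (w' b))) := gram.
rewrite !mxE (inj_eq (can_inj Kg)) (inj_eq (can_inj gK')) => <-.
rewrite (reindex (g \o w')) /=; last first.
  by exists (g' \o w) => c _ /=; rewrite ?Kg ?gK' ?Kg' ?gK.
by apply: eq_bigr => c _; rewrite !mxE !Kg.
Qed.

(** A diagonal Gram entry is the sum of the squares of a column with entries 0, 1, -1, hence a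
    degree. The bound [0 < n] supplies a vertex attaining the maximum. *)
Lemma gram_max_degree n (w : vertex_order n T) (d : nat) : (0 < n)%N ->
  (skew_adj sigma w)^T *m skew_adj sigma w = d%:R%:M -> max_degree G = d.
Proof.
move=> n0 gram; have [g gK Kg] := vertex_at_bij w.
have deg x : degree G x = d.
  have /matrixP/(_ (g x) (g x)) := gram.
  rewrite !mxE eqxx mulr1n (eq_bigr (fun c => (adj G x (w c))%:R)) => [|c _].
    move/eqP; rewrite -natr_sum eqr_nat => /eqP <-.
    rewrite /degree -sum1dep_card big_mkcond /= (reindex w) /=.
      by apply: eq_bigr => c _; case: adj.
    by exists g => c _.
  by rewrite mxE -expr2 skew_adj_sqr_entry Kg adj_sym.
rewrite /max_degree; apply/eqP; rewrite eqn_leq; apply/andP; split.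
  by apply/bigmax_leqP => x _; rewrite deg.
by rewrite -(deg (w (Ordinal n0))); apply: leq_bigmax.
Qed.

(** Skew symmetry turns the Gram identity into [M M = -d I]; applied to an eigenvector, this gives
    [z z = -d]. *)
Lemma gram_eigenvalue_norm n (w : vertex_order n T) (d : nat) z :
  (skew_adj sigma w)^T *m skew_adj sigma w = d%:R%:M ->
  z \in eigenvalues (map_mx intr (skew_adj sigma w)) -> `|z| = sqrtC d%:R.
Proof.
move=> gram; rewrite /eigenvalues; set M := map_mx _ _.
case: closed_field_poly_normal => r /= charE zr.
have sqM : M *m M = - (d%:R)%:M.
  rewrite -map_mxM -[X in X *m _]opprK -skew_adj_tr mulNmx gram.
  by rewrite map_mxN map_scalar_mx rmorph_nat.
have : eigenvalue M z.
  rewrite eigenvalue_root_char charE (monicP (char_poly_monic _)) scale1r.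
  by rewrite root_prod_XsubC.
case/eigenvalueP => v vM v0.
have zz : z * z = - d%:R.
  have : v *m M *m M = (z * z) *: v by rewrite vM -scalemxAl vM scalerA.
  rewrite -mulmxA sqM mulmxN mul_mx_scalar -scaleNr => /eqP.
  by rewrite -subr_eq0 -scalerBl scaler_eq0 (negbTE v0) orbF subr_eq0 => /eqP.
have -> : d%:R = `|z| ^+ 2 :> algC by rewrite -normrX expr2 zz normrN normr_nat.
by rewrite sqrCK ?normr_ge0.
Qed.

Lemma gram_optimum_skew_energy n (w : vertex_order n T) (d : nat) :
  (0 < n)%N -> (skew_adj sigma w)^T *m skew_adj sigma w = d%:R%:M ->
  optimum_skew_energy sigma.
Proof.
move=> n0 gram; rewrite /optimum_skew_energy /skew_energy.
rewrite (gram_max_degree n0 gram).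
have gram' := skew_adj_gram_order (enum_order T) gram.
rewrite big_seq (eq_bigr (fun=> sqrtC d%:R)); last first.
  by move=> z; apply: gram_eigenvalue_norm.
rewrite -big_seq big_const_seq count_predT iter_addr_0 mulr_natl; congr (_ *+ _).
(* It remains to count the eigenvalues: the characteristic polynomial has size [#|T| + 1] and splits
   into linear factors. *)
rewrite /eigenvalues; set M := map_mx _ _.
case: closed_field_poly_normal => r /= charE; apply: succn_inj.
rewrite -(size_char_poly M) charE (monicP (char_poly_monic _)) scale1r.
by rewrite size_prod_XsubC.
Qed.

End SkewSpectrum.

(** The arcs are the pairs where [M] has entry 1; skew symmetry puts -1 at the reversed pair, so no
    arc is reversed. *)
Lemma skew_matrix_orientation (T : finType) (G : sgraph T) n
    (w : vertex_order n T) (M : 'M[int]_n) :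
  M^T = - M -> (forall a b, M a b \in [:: 0; 1; -1]) ->
  (forall a b, adj G (w a) (w b) = (M a b != 0)) ->
  exists sigma : orientation G, skew_adj sigma w = M.
Proof.
move=> skewM M01 adjM; have [g gK Kg] := vertex_at_bij w.
have Mtr a b : M b a = - M a b by have /matrixP/(_ a b) := skewM; rewrite !mxE.
pose e x y := M (g x) (g y) == 1.
have adj_e x y : adj G x y = e x y || e y x.
  rewrite -{1}(Kg x) -{1}(Kg y) adjM /e (Mtr (g x)).
  by have := M01 (g x) (g y); rewrite !inE => /or3P[] /eqP ->.
have asym_e x y : e x y -> ~~ e y x by rewrite /e (Mtr (g x)) => /eqP ->.
exists (Orientation adj_e asym_e); apply/matrixP=> a b.
rewrite mxE /= /e !gK (Mtr a).
by have := M01 a b; rewrite !inE => /or3P[] /eqP ->.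
Qed.

(** * Entries of [S_mx] and its Gram identity *)

Section Entries.
Variable j : nat.
Hypothesis j_gt0 : (0 < j)%N.

Definition A_rows : seq (seq int) := [:: [:: 1; 1; 1; 1]; [:: 1; 1; -1; -1]].
Definition B_rows : seq (seq int) :=
  [:: [:: 1; 1; 0; 0]; [:: -1; -1; 0; 0]; [:: 0; 0; 1; 1]; [:: 0; 0; -1; -1]].
Definition D_rows : seq (seq int) :=
  [:: [:: -1; 1]; [:: 1; -1]; [:: -1; -1]; [:: 1; 1]].

Definition upper_rows (k : nat) : seq (seq int) :=
  if k == 0%N then A_rows else if k == j then D_rows else B_rows.

(** Indices are plain natural numbers, so that computations avoid matrix types whose dimensions
    depend on the block. *)
Definition upper_entry (k a b : nat) : int :=
  nth 0 (nth [::] (upper_rows k) a) b.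

(** The entry of [S] at the positions [a] and [b] of the blocks [k] and [l]. *)
Definition S_entry (k l a b : nat) : int :=
  if l == k.+1 then upper_entry k a b
  else if k == l.+1 then - upper_entry l b a
  else 0.

Definition level_size (k : nat) : nat :=
  if (k == 0%N) || (k == j.+1) then 2 else 4.

Lemma conform_mx_of_rows m n m' n' rows (em : m = m') (en : n = n') a b :
  conform_mx (0 : 'M_(m', n')) (mx_of_rows m n rows) a b
    = nth 0 (nth [::] rows a) b.
Proof. by case: _ / em a; case: _ / en b => a b; rewrite conform_mx_id mxE. Qed.

Lemma upper_blockE (k l : 'I_j.+2) a b : l = k.+1 :> nat ->
  upper_block k l a b = upper_entry k a b.
Proof.
move=> lk; rewrite /upper_block /upper_entry /upper_rows.
have lj := ltn_ord l.
case: eqP => [k0|/eqP k0]; last case: eqP => [kj|/eqP kj];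
  by apply: conform_mx_of_rows; rewrite /block_size; case: ifP; lia.
Qed.

Lemma S_blockE (k l : 'I_j.+2) a b : S_block k l a b = S_entry k l a b.
Proof.
rewrite /S_block /S_entry; case: eqP => [lk|_]; first exact: upper_blockE.
case: eqP => [kl|_]; last by rewrite mxE.
by rewrite !mxE upper_blockE.
Qed.

Lemma S_entry_skew k l a b : S_entry l k b a = - S_entry k l a b.
Proof.
by rewrite /S_entry; do 2 (case: eqP => ?); rewrite ?opprK ?oppr0 //; lia.
Qed.

Lemma upper_entry_mem k a b : upper_entry k a b \in [:: 0; 1; -1].
Proof.
have /(all_nthP [::]) row_mem :
    all (all (fun x : int => x \in [:: 0; 1; -1])) (upper_rows k).
  by rewrite /upper_rows; case: eqP => // _; case: eqP.
rewrite /upper_entry.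
have [sa|/row_mem /(all_nthP 0) b_mem] := leqP (size (upper_rows k)) a.
  by rewrite (nth_default [::] sa) nth_nil.
have [sb|/b_mem ->//] := leqP (size (nth [::] (upper_rows k) a)) b.
by rewrite nth_default.
Qed.

Lemma S_entry_mem k l a b : S_entry k l a b \in [:: 0; 1; -1].
Proof.
rewrite /S_entry; case: ifP => _; first exact: upper_entry_mem.
case: ifP => // _; have := upper_entry_mem l b a.
by rewrite !inE => /or3P[] /eqP ->.
Qed.

(** Reduces a sum over all blocks to the two neighbours of block [k]; the conditionals on the right
    handle the first and last blocks. *)
Lemma sum_adjacent n (k : nat) (F G : nat -> int) : (k < n)%N ->
  \sum_(l < n) (if (l : nat) == k.+1 then F l
                else if k == l.+1 then G l else 0)
  = (if (k.+1 < n)%N then F k.+1 else 0) + (if (0 < k)%N then G k.-1 else 0).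
Proof.
move=> kn.
rewrite (eq_bigr (fun l : 'I_n => (if (l : nat) == k.+1 then F l else 0)
    + (if (0 < k)%N then if (l : nat) == k.-1 then G l else 0 else 0))); last first.
  move=> l _; case: (posnP k) => [->|k0]; rewrite ?addr0 //.
  have -> : (k == l.+1) = ((l : nat) == k.-1) by lia.
  by case: eqP => [->|_]; rewrite ?add0r //; case: eqP; rewrite ?addr0 //; lia.
rewrite big_split /= -big_mkcond big_ord1_eq; congr (_ + _).
case: (posnP k) => [_|k0]; first by rewrite big1.
by rewrite -big_mkcond big_ord1_eq; case: ifP => //; lia.
Qed.

(** Here [a./2] numbers the pairs of positions 0, 1 and 2, 3. The case [k = 0] is [A A^T]; [B B^T]
    and [D D^T] coincide, so they share one formula. *)
Lemma upper_row_gram k a b : (k <= j)%N ->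
  (a < level_size k)%N -> (b < level_size k)%N ->
  \sum_(c < level_size k.+1) upper_entry k a c * upper_entry k b c
    = if k == 0%N then (a == b)%:R * 4
      else if a./2 == b./2 then if a == b then 2 else -2 else 0.
Proof.
move=> kj; rewrite /level_size /upper_entry /upper_rows eqSS /=.
rewrite [k == j.+1]ltn_eqF // orbF.
case: eqP => [->|k0].
  rewrite (ltn_eqF j_gt0) => a2 b2; rewrite !big_ord_recr big_ord0 /=.
  by do 2 (case: a a2 => [|a] a2; first by do 2 (case: b b2 => [|b] b2 //)).
by case: eqP => _ a4 b4; rewrite !big_ord_recr big_ord0 /=;
  do 4 (case: a a4 => [|a] a4; first by do 4 (case: b b4 => [|b] b4 //)).
Qed.

(** The case [k = j] is [D^T D]; otherwise [A^T A] and [B^T B] coincide. *)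
Lemma upper_col_gram k a b : (k <= j)%N ->
  (a < level_size k.+1)%N -> (b < level_size k.+1)%N ->
  \sum_(c < level_size k) upper_entry k c a * upper_entry k c b
    = if k == j then (a == b)%:R * 4
      else (a./2 == b./2)%:R * 2.
Proof.
move=> kj; rewrite /level_size /upper_entry /upper_rows eqSS /=.
rewrite [k == j.+1]ltn_eqF // orbF.
case: (k =P j) => [->|kj'].
  rewrite (gtn_eqF j_gt0) => a2 b2; rewrite !big_ord_recr big_ord0 /=.
  by do 2 (case: a a2 => [|a] a2; first by do 2 (case: b b2 => [|b] b2 //)).
by case: eqP => _ a4 b4; rewrite !big_ord_recr big_ord0 /=;
  do 4 (case: a a4 => [|a] a4; first by do 4 (case: b b4 => [|b] b4 //)).
Qed.

(** The left factor, [A] or [B], has equal columns within each pair of positions, while the right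
    factor, [B] or [D], has opposite rows there, so the terms cancel in pairs. *)
Lemma upper_comp k a b : (k < j)%N ->
  (a < level_size k)%N -> (b < level_size k.+2)%N ->
  \sum_(c < level_size k.+1) upper_entry k a c * upper_entry k.+1 c b = 0.
Proof.
move=> kj; rewrite /level_size /upper_entry /upper_rows !eqSS /=.
rewrite (ltn_eqF kj) (ltn_eqF (ltnW kj : k < j.+1)%N) orbF.
case: (k =P 0%N) => _; case: (k.+1 =P j) => _ a4 b4;
  rewrite !big_ord_recr big_ord0 /=;
  by do 4 (case: a a4 => [|a] a4 //; first by do 4 (case: b b4 => [|b] b4 //)).
Qed.

Lemma S_entry_gram k m a b : (k < j.+2)%N -> (m < j.+2)%N ->
  (a < level_size k)%N -> (b < level_size m)%N ->
  \sum_(l < j.+2) \sum_(c < level_size l) S_entry l k c a * S_entry l m c b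
    = ((k == m) && (a == b))%:R * 4.
Proof.
move=> kj mj ak bm.
rewrite (eq_bigr (fun l : 'I_j.+2 =>
   if (l : nat) == k.+1 then
     \sum_(c < level_size l) - upper_entry k a c * S_entry l m c b
   else if k == l.+1 then
     \sum_(c < level_size l) upper_entry l c a * S_entry l m c b else 0));
  last first.
  move=> l _; case: ifP => [lk|lk].
    by apply: eq_bigr => c _; rewrite (S_entry_skew k) {1}/S_entry lk.
  case: ifP => [kl|kl].
    by apply: eq_bigr => c _; rewrite {1}/S_entry kl.
  by apply: big1 => c _; rewrite {1}/S_entry kl lk mul0r.
rewrite (sum_adjacent
  (fun l => \sum_(c < level_size l) - upper_entry k a c * S_entry l m c b)
  (fun l => \sum_(c < level_size l) upper_entry l c a * S_entry l m c b)) //.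
(* Neighbour [k + 1]: for [m = k] the two minus signs cancel, for [m = k + 2] consecutive blocks
   multiply to 0, and otherwise the second factor is 0. *)
have -> : (if (k.+1 < j.+2)%N then
     \sum_(c < level_size k.+1) - upper_entry k a c * S_entry k.+1 m c b else 0)
   = if (k < j.+1)%N && (k == m) then
       \sum_(c < level_size k.+1) upper_entry k a c * upper_entry k b c else 0.
  rewrite ltnS; case: ltnP => //= kj1; case: (k =P m) => [km|/eqP km].
    apply: eq_bigr => c _; rewrite /S_entry -km eqxx.
    by rewrite (ltn_eqF (leqnSn k.+1)) mulrNN.
  have [mk|mk] := m =P k.+2; last first.
    rewrite /= big1 // => c _; rewrite /S_entry (negPf (introN eqP mk)).
    by rewrite eqSS (negPf km) mulr0.
  have kj' : (k < j)%N by lia.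
  rewrite mk in bm *; apply: oppr_inj; rewrite oppr0 -sumrN.
  rewrite -[RHS](upper_comp kj' ak bm); apply: eq_bigr => c _.
  by rewrite mulNr opprK /S_entry eqxx.
(* Neighbour [k - 1]: the same alternatives, with [m = k - 2] giving the transpose of a vanishing
   product. *)
have -> : (if (0 < k)%N then
     \sum_(c < level_size k.-1) upper_entry k.-1 c a * S_entry k.-1 m c b else 0)
   = if (0 < k)%N && (k == m) then
       \sum_(c < level_size k.-1) upper_entry k.-1 c a * upper_entry k.-1 c b else 0.
  case: k kj ak => [|k] //= kj ak; case: (k.+1 =P m) => [<-|/eqP km].
    by apply: eq_bigr => c _; rewrite /S_entry eqxx.
  rewrite eq_sym in km; have [mk|mk] := k =P m.+1; last first.
    rewrite /= big1 // => c _; rewrite /S_entry (negPf km).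
    by rewrite (negPf (introN eqP mk)) mulr0.
  have mj' : (m < j)%N by lia.
  rewrite mk /= in ak *; apply: oppr_inj; rewrite oppr0 -sumrN.
  rewrite -[RHS](upper_comp mj' bm ak); apply: eq_bigr => c _.
  by rewrite /S_entry eqxx (ltn_eqF (leqnSn m.+1)) mulrN opprK mulrC.
(* On the diagonal, an end block has a single neighbour, contributing [4 I]. In a middle block the
   off-diagonal 2 and -2 within a pair cancel and the diagonal adds up to 2 + 2. *)
case: (k =P m) bm => [<-|_ _]; last by rewrite !andbF mul0r addr0.
rewrite !andbT /= => bk; case: (ltnP k j.+1) => kj1.
  rewrite upper_row_gram //.
  case: k {kj} ak bk kj1 => [|k] ak bk kj1 /=; first by rewrite addr0.
  rewrite (upper_col_gram (ltnW (kj1 : k < j)%N)) // (ltn_eqF (kj1 : k < j)%N).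
  by case: (a =P b) => [->|_]; rewrite ?eqxx //; case: eqP.
have {}kj1 : k = j.+1 by lia.
by rewrite kj1 /= upper_col_gram -?kj1 //= eqxx add0r.
Qed.

Lemma S_mx_gram : (S_mx j)^T *m S_mx j = 4%:M.
Proof.
have castP n n' (e : n = n') (M : 'M[int]_n) : M^T *m M = 4%:M ->
    (castmx (e, e) M)^T *m castmx (e, e) M = 4%:M.
  by case: _ / e; rewrite castmx_id.
apply: castP; rewrite tr_mxblock mul_mxblock; apply/matrixP=> x y.
rewrite !mxE summxE.
under eq_bigr => l _.
  rewrite mxE; under eq_bigr => c _ do rewrite mxE !S_blockE.
  over.
rewrite S_entry_gram //; try exact: (ltn_ord (tagnat.sig2 _)).
rewrite mulr_natl; congr (_ *+ nat_of_bool _).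
rewrite -[in RHS](tagnat.sig2K x) -[in RHS](tagnat.sig2K y).
by rewrite -val_eqE /= tagnat.eq_Rank.
Qed.

End Entries.

(** * Matching the nonzero entries of [S_mx] with the edges of [H_graph] *)

Section Labels.
Local Open Scope nat_scope.
Variable j : nat.
Hypothesis j_gt0 : (0 < j)%N.

Lemma label_eqE :
  ((forall a b, (Lui a == Lui b) = (a == b))
   * (forall a b, (Lvi a == Lvi b) = (a == b)))
  * ((forall a b, (Lui a == Lvi b) = false)
   * (forall a b, (Lvi a == Lui b) = false)
   * (forall a, (Lui a == Lu) = false) * (forall a, (Lui a == Lv) = false)
   * (forall a, (Lvi a == Lu) = false) * (forall a, (Lvi a == Lv) = false)
   * (forall a, (Lu == Lui a) = false) * (forall a, (Lv == Lui a) = false)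
   * (forall a, (Lu == Lvi a) = false) * (forall a, (Lv == Lvi a) = false)
   * ((Lu == Lv) = false) * ((Lv == Lu) = false)).
Proof. by []. Qed.

(** Arithmetic form of membership in [H_edges]: for [0 < a], [a.+1./2] is the [k] with [a] equal to
    [2 * k - 1] or [2 * k]. *)
Definition H_edge (x y : label) : bool :=
  match x, y with
  | Lu, Lui b | Lu, Lvi b | Lv, Lui b | Lv, Lvi b => 0 < b <= 2
  | Lui a, Lui b => [&& 0 < a, a <= 2 * j & b.+1./2 == a.+1./2.+1]
  | Lvi a, Lvi b => [&& 0 < a, a <= 2 * (j - 1) & b.+1./2 == a.+1./2.+1]
  | Lvi a, Lui b => (a.+1./2 == j) && (b.+1./2 == j.+1)
  | _, _ => false
  end.

Definition rungs (C : nat -> label) n : seq (label * label) :=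
  flatten [seq [seq (x, y) | x <- [:: C (2 * k - 1); C (2 * k)],
                             y <- [:: C (2 * k + 1); C (2 * k + 2)]]
          | k <- iota 1 n].

Lemma mem_rungs C n a b : (forall a b, (C a == C b) = (a == b)) ->
  ((C a, C b) \in rungs C n) = [&& 0 < a, a <= 2 * n & b.+1./2 == a.+1./2.+1].
Proof.
move=> eqC; apply/flatten_mapP/idP => [[k]|ab].
  by rewrite mem_iota !inE !xpair_eqE !eqC; lia.
by exists a.+1./2; rewrite ?mem_iota ?inE ?xpair_eqE ?eqC; lia.
Qed.

Lemma notin_rungs C n x y : (forall a b, (x, y) <> (C a, C b)) ->
  ((x, y) \in rungs C n) = false.
Proof.
move=> out; apply/negP => /flatten_mapP[k _].
by rewrite !inE => /or4P[] /eqP /out.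
Qed.

Lemma mem_H_edges x y : ((x, y) \in H_edges j) = H_edge x y.
Proof.
rewrite /H_edges -/(rungs Lui j) -/(rungs Lvi (j - 1)) !mem_cat.
case: x => [||a|a]; case: y => [||b|b];
  rewrite ?(mem_rungs (C := Lui)) ?(mem_rungs (C := Lvi)) //
          ?(notin_rungs (C := Lui)) ?(notin_rungs (C := Lvi)) //;
  rewrite !inE !xpair_eqE !label_eqE /= ?andbF ?orbF //; lia.
Qed.

(** The stretch of [H_order_seq] that indexes block [k] of [S_mx]. *)
Definition level (k : nat) : seq label :=
  if k == 0 then [:: Lu; Lv]
  else if k == j.+1 then [:: Lui (2 * j + 1); Lui (2 * j + 2)]
  else [:: Lui (2 * k - 1); Lui (2 * k); Lvi (2 * k - 1); Lvi (2 * k)].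

(** Every edge is listed from a level to the next one, as the superdiagonal blocks are. Once the
    shapes of both levels are fixed, at most 4 by 4 positions need checking. *)
Lemma H_edges_level k l c d : k < j.+2 -> l < j.+2 ->
  c < level_size j k -> d < level_size j l ->
  ((nth Lu (level k) c, nth Lu (level l) d) \in H_edges j)
    = (l == k.+1) && (upper_entry j k c d != 0%R).
Proof.
move=> kj lj; rewrite mem_H_edges /level /level_size /upper_entry /upper_rows.
case: (k =P 0) => k0; case: (l =P 0) => l0; case: (k =P j.+1) => k1;
  case: (l =P j.+1) => l1; case: (k =P j) => k2; try (exfalso; lia);
  rewrite /= => ck dl.
all: do 4 (case: c ck => [|c] ck //; first by
  do 4 (case: d dl => [|d] dl //; first by rewrite /=; lia)).
Qed.

Lemma nth_flatten4 (f : nat -> seq label) m n q c :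
  (forall k, size (f k) = 4) ->
  q < n -> c < 4 ->
  nth Lu (flatten [seq f k | k <- iota m n]) (4 * q + c) = nth Lu (f (m + q)) c.
Proof.
move=> sf; elim: n m q => // n IH m [|q] qn c4 /=.
  by rewrite nth_cat sf c4 addn0.
rewrite nth_cat sf ltnNge (_ : 4 <= _) /=; last lia.
by rewrite -addSnnS -IH //; congr nth; lia.
Qed.

(** For [0 < k], level [k] starts after 2 + 4 (k - 1) labels; for [k = 0] truncated subtraction
    gives the correct start 0. *)
Lemma nth_H_order_level k c : k < j.+2 -> c < level_size j k ->
  nth Lu (H_order_seq j) (4 * k - 2 + c) = nth Lu (level k) c.
Proof.
case: k => [|k] kj; rewrite /level /level_size /=; first by case: c => [|[]].
rewrite eqSS => ck; rewrite (_ : 4 * k.+1 - 2 + c = (4 * k + c).+2); last lia.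
rewrite /= nth_cat size_flatten /shape -map_comp /=.
rewrite (eq_map (g := fun=> 4)) // sumnE big_map big_const_seq count_predT.
rewrite size_iota iter_addn_0; case: eqP ck => [->|kj'] ck.
  by rewrite ltnNge leq_addr addKn.
rewrite (_ : _ < _); last lia.
by rewrite nth_flatten4 //; lia.
Qed.

Definition index_sig (i : 'I_(4 * j + 4)) : 'I_(\sum_k @block_size j k) :=
  cast_ord (esym (sum_block_size j)) i.
Definition index_level (i : 'I_(4 * j + 4)) : 'I_j.+2 :=
  tagnat.sig1 (index_sig i).
Definition index_pos (i : 'I_(4 * j + 4)) : 'I_(level_size j (index_level i)) :=
  tagnat.sig2 (index_sig i).

Lemma index_levelE (i : 'I_(4 * j + 4)) :
  i = 4 * index_level i - 2 + index_pos i :> nat.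
Proof.
transitivity (index_sig i : nat) => //; rewrite [LHS]tagnat.rect; congr (_ + _).
rewrite -/(index_level i); have kj := ltn_ord (index_level i).
rewrite (big_ord_narrow (ltnW kj)); move: kj (ltnW kj).
case: (nat_of_ord (index_level i)) => [|k] kj kj'; first by rewrite big_ord0.
rewrite big_ord_recl (eq_bigr (fun=> 4)) => [|l _].
  by rewrite sum_nat_const card_ord /block_size /=; lia.
(* The blocks strictly between block 0 and the current one are never the last block, so they have
   size 4. *)
by rewrite /block_size /=; case: ifP; have := ltn_ord l; rewrite /bump /=; lia.
Qed.

Lemma H_order_level (i : 'I_(4 * j + 4)) :
  val (H_order j i) = nth Lu (level (index_level i)) (index_pos i).
Proof. by rewrite /= {1}index_levelE nth_H_order_level. Qed.

Lemma S_mxE a b :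
  S_mx j a b
    = S_entry j (index_level a) (index_level b) (index_pos a) (index_pos b).
Proof. by rewrite castmxE mxE S_blockE. Qed.

Lemma H_adj_S_mx a b :
  adj (H_graph j) (H_order j a) (H_order j b) = (S_mx j a b != 0%R).
Proof.
transitivity (H_adj (H_order j a) (H_order j b)) => //.
rewrite /H_adj !H_order_level !H_edges_level // S_mxE /S_entry.
case: eqP => [ba|_] /=; last by case: ifP; rewrite ?oppr_eq0 ?eqxx.
(* When [b] lies one level above [a], the reversed pair is not listed. *)
by rewrite (_ : (index_level a == _.+1 :> nat) = false) ?orbF //; lia.
Qed.

End Labels.

Theorem theorem3p6 (j : nat) (hj : (0 < j)%N) :
  exists sigma : orientation (H_graph j),
    [/\ skew_adj sigma (H_order j) = S_mx j,
        (S_mx j)^T *m S_mx j = 4%:M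
      & optimum_skew_energy sigma].
Proof.
have gram := S_mx_gram hj.
have [||a b|sigma sigmaE] :=
  @skew_matrix_orientation _ (H_graph j) _ (H_order j) (S_mx j).
- by apply/matrixP=> a b; rewrite mxE [RHS]mxE !S_mxE // S_entry_skew.
- by move=> a b; rewrite S_mxE // S_entry_mem.
- exact: H_adj_S_mx.
exists sigma; split=> //.
apply: (gram_optimum_skew_energy (w := H_order j) (d := 4)); first by rewrite addn4.
by rewrite sigmaE.
Qed.
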